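(* Let $\Delta\geq 3$ be an integer and let $G$ be a connected $\Delta$-regular graph of order $n$. Then $$\gamma_e(G)\leq \frac{\Delta(2\Delta-3)n+2\Delta}{2(\Delta-1)(2\Delta-1)},$$ with equality if and only if $G$ is the complete bipartite graph $K_{\Delta,\Delta}$.
   Context: All graphs are finite, simple and undirected. A matching $M$ in $G$ is maximal if it is maximal with respect to inclusion among matchings. The edge domination number $\gamma_e(G)$ is the minimum size of a maximal matching in $G$. *)

(* Defs.v *)
From mathcomp Require Import all_boot all_order all_algebra.

Set Implicit Arguments.
Unset Strict Implicit.
Unset Printing Implicit Defensive.

Record sgraph := SGraph {
  vertex :> finType;
  adj : rel vertex;
  adj_sym : symmetric adj;
  adj_irr : irreflexive adj }.

Definition edges (G : sgraph) : {set {set G}} :=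
  [set A | [exists x : G, exists y : G, adj x y && (A == [set x; y])]].

(* The graph with no vertex is not connected. *)
Definition connected (G : sgraph) : Prop :=
  0 < #|G| /\ forall x y : G, connect (@adj G) x y.

Definition regular (d : nat) (G : sgraph) : Prop :=
  forall x : G, #|[set y | adj x y]| = d.

Definition matching (G : sgraph) (M : {set {set G}}) : bool :=
  (M \subset edges G) && trivIset M.

Definition maximal_matching (G : sgraph) (M : {set {set G}}) : bool :=
  maxset (@matching G) M.

Lemma ex_maximal_matching (G : sgraph) :
  exists k, [exists M : {set {set G}}, maximal_matching M && (#|M| == k)].
Proof.
have m0 : matching (set0 : {set {set G}}).
  rewrite /matching sub0set; apply/trivIsetP => A B; by rewrite inE.
have [M maxM _] := maxset_exists m0.
by exists #|M|; apply/existsP; exists M; rewrite /maximal_matching maxM eqxx.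
Qed.

Definition edge_domination_number (G : sgraph) : nat :=
  ex_minn (ex_maximal_matching G).

Definition isomorphic (G H : sgraph) : Prop :=
  exists f : G -> H, bijective f /\ forall x y, adj (f x) (f y) = adj x y.

Definition biclique_adj (m n : nat) : rel ('I_m + 'I_n)%type :=
  fun u v => match u, v with
    | inl _, inr _ | inr _, inl _ => true
    | _, _ => false
    end.

Lemma biclique_sym (m n : nat) : symmetric (@biclique_adj m n).
Proof. by move=> [x|x] [y|y]. Qed.

Lemma biclique_irr (m n : nat) : irreflexive (@biclique_adj m n).
Proof. by case. Qed.

Definition complete_bipartite (m n : nat) : sgraph :=
  SGraph (@biclique_sym m n) (@biclique_irr m n).

(* Main.v *)
(* A maximal matching M leaves an independent set of n - 2|M| vertices unmatched,
   so the theorem says that some maximal matching leaves more than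
   (n - 2d)/((d-1)(2d-1)) vertices unmatched unless G is K_{d,d}.

   Grow greedily a set I together with a matching f that misses I and covers
   N(I), each new vertex of I being adjacent to the set S of matched vertices, so
   that |S| <= 2((d-1)|I| + 1). When no vertex x with a neighbour in S can be
   added, a matching leaving x unmatched can never cover N(x); an exchange
   argument along alternating paths then shows that the vertices outside S
   adjacent to x also have a neighbour in S, hence by connectivity all vertices of
   T = V - S - I do, and counting the edges leaving S gives
   n <= (d-1)(2d-1)|I| + 2d. If not even a first vertex can be chosen, the same
   exchange argument gives n <= 2d with equality only for K_{d,d}.

   If the count is tight and no maximal matching misses more than |I| vertices,
   then S induces a perfect matching, every vertex of T has exactly one neighbour
   in S, and many edges vw of f are leaves: v has one neighbour in I and w has
   none. Two leaves v1w1 and v2w2 share their neighbour u in I, and rematching u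
   with v2 and w1 with a vertex of T yields a matching missing two more vertices. *)

Require Import Defs.
From mathcomp Require Import all_boot all_order all_algebra.
From mathcomp Require Import zify ring lra.

Set Implicit Arguments.
Unset Strict Implicit.
Unset Printing Implicit Defensive.

Import Order.TTheory GRing.Theory Num.Theory.

(** * Matchings as involutions, and exchange along alternating paths *)

Section Exchange.
Variable G : sgraph.
Implicit Types (f g h : {ffun G -> G}) (x y z u v w : G) (A B I : {set G}).

(** A matching is encoded as an involution that sends each matched vertex to its partner; the
    unmatched vertices are its fixed points. *)
Definition is_matching f : bool :=
  [forall x, (f (f x) == x) && ((f x == x) || adj x (f x))].

Lemma is_matchingP f :
  reflect (involutive f /\ forall x, f x != x -> adj x (f x)) (is_matching f).
Proof.
apply: (iffP forallP) => [fP|[fK fadj] x].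
  split=> x; first by case/andP: (fP x) => /eqP.
  by case/andP: (fP x) => _ /orP[->|].
by rewrite fK eqxx /=; case: eqP => //= /eqP /fadj.
Qed.

Lemma adj_neq x y : adj x y -> x != y.
Proof. by apply: contraTneq => ->; rewrite adj_irr. Qed.

(** Rematching: the edge [qr] enters the matching, and the former partners of [q] and [r] become
    unmatched. *)
Definition link f q r : {ffun G -> G} :=
  [ffun x => if x == q then r else if x == r then q
             else if (x == f q) || (x == f r) then x else f x].

Lemma link_fixed f q r x : adj q r ->
  (link f q r x == x) =
    [&& x != q, x != r & [|| f x == x, x == f q | x == f r]].
Proof.
move=> qr; rewrite ffunE; case: (eqVneq x q) => [->|_] /=.
  by apply/negbTE; rewrite eq_sym adj_neq.
case: (eqVneq x r) => [->|_] /=; first by apply/negbTE; rewrite adj_neq.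
by case: ifP => _; rewrite ?orbF // eqxx orbT.
Qed.

Lemma link_matching f q r :
  is_matching f -> adj q r -> is_matching (link f q r).
Proof.
move=> /is_matchingP[fK fadj] qr; have nqr := adj_neq qr.
apply/is_matchingP; split=> x; rewrite !ffunE.
  case: (eqVneq x q) => [->|xq]; first by rewrite eq_sym (negbTE nqr) eqxx.
  case: (eqVneq x r) => [->|xr]; first by rewrite eqxx.
  case: (boolP ((x == f q) || (x == f r))) => [xf|/norP[xfq xfr]].
    by rewrite (negbTE xq) (negbTE xr) xf.
  rewrite !(inv_eq fK) (negbTE xfq) (negbTE xfr) !fK.
  by rewrite (negbTE xq) (negbTE xr).
case: (eqVneq x q) => [->|xq] //.
case: (eqVneq x r) => [->|xr]; first by rewrite adj_sym.
by case: ifP => [|_ /fadj //]; rewrite eqxx.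
Qed.

Definition extends f g := is_matching g /\ forall x, f x != x -> g x = f x.

Lemma extends_refl f : is_matching f -> extends f f.
Proof. by []. Qed.

Lemma extends_trans f g h : extends f g -> extends g h -> extends f h.
Proof.
move=> [gM fg] [hM gh]; split=> // x fx; rewrite gh fg //.
Qed.

Lemma extends_fixed f g x : extends f g -> g x = x -> f x = x.
Proof. by case=> _ fg gx; apply/eqP/negP => /negP fx; move: (fx); rewrite -fg ?gx ?eqxx. Qed.

Lemma extends_free f g x :
  is_matching f -> extends f g -> f x = x -> f (g x) = g x.
Proof.
move=> /is_matchingP[fK _] [/is_matchingP[gK _] fg] fx.
apply/eqP/negP => /negP fgx; move: (fg _ fgx); rewrite gK => e.
by move: fgx; rewrite -e -{1}fx e fK -e eqxx.
Qed.

Lemma link_extends f g q r : is_matching f ->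
  extends f g -> f q = q -> f r = r -> adj q r -> extends f (link g q r).
Proof.
move=> fM fg fq fr qr; split; first by apply: link_matching => //; case: fg.
move=> x fx; rewrite ffunE.
have nx t : f t = t -> (x == t) = false by move=> ft; apply: contraNF fx => /eqP->; rewrite ft.
by rewrite !nx //=; [case: fg => _ -> | apply: extends_free..].
Qed.

Definition independent A := forall x y, x \in A -> y \in A -> ~~ adj x y.

Definition fixed f : {set G} := [set x | f x == x].

Lemma maximal_extension f : is_matching f ->
  exists2 g, extends f g & independent (fixed g).
Proof.
move: {2}(#|_|) (leqnn #|fixed f|) => m; elim: m f => [|m IH] f.
  rewrite leqn0 cards_eq0 => /eqP f0 fM; exists f; first exact: extends_refl.
  by move=> x y; rewrite f0 inE.
move=> lem fM; case: (boolP [exists x in fixed f, exists y in fixed f, adj x y]).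
  case/exists_inP=> x xf /exists_inP[y yf xy].
  have := xf; have := yf; rewrite !inE => /eqP fy /eqP fx.
  have fl : extends f (link f x y) by apply: link_extends.
  have [|//|g lg gi] := IH (link f x y); last by exists g => //; apply: extends_trans lg.
    rewrite -ltnS; apply: leq_trans lem; apply: proper_card; apply/properP; split.
      by apply/subsetP=> t; rewrite !inE link_fixed // fx fy => /and3P[/negbTE-> /negbTE->]; rewrite !orbF.
    by exists x => //; rewrite inE link_fixed // eqxx.
  by case: fl.
move/exists_inPn => H; exists f; first exact: extends_refl.
by move=> x y xf; apply: (exists_inPn (H x xf)).
Qed.

Definition nbhd x : {set G} := [set y | adj x y].

Lemma in_nbhd x y : (y \in nbhd x) = adj x y. Proof. by rewrite inE. Qed.

Definition free_deg f x := #|nbhd x :&: fixed f|.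

(** The obstruction to adding [x] to the set [I]: no extension of [f] that misses [x] covers its
    neighbourhood. *)
Definition stuck f x :=
  f x = x /\ forall g, extends f g -> g x = x -> exists2 y, adj x y & g y = y.

Definition optimal f x g :=
  [/\ extends f g, g x = x &
  forall h, extends f h -> h x = x ->
     #|nbhd x :&: fixed g| <= #|nbhd x :&: fixed h|].

Lemma optimal_exists f x : is_matching f -> f x = x -> exists g, optimal f x g.
Proof.
move=> fM fx.
pose P (g : {ffun G -> G}) :=
  [&& is_matching g, [forall z, (f z != z) ==> (g z == f z)] & g x == x].
have PE g : reflect (extends f g /\ g x = x) (P g).
  apply: (iffP and3P) => [[gM /forallP fg /eqP gx]|[[gM fg] gx]].
    by split=> //; split=> // z fz; apply/eqP; move: (fg z); rewrite fz.
  by split; rewrite ?gx //; apply/forallP=> z; apply/implyP=> /fg->.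
have Pf : P f by apply/PE.
case: (arg_minnP (fun g : {ffun G -> G} => #|nbhd x :&: fixed g|) Pf) => g /PE[fg gx] ming.
by exists g; split=> // h fh hx; apply: ming; apply/PE.
Qed.

(** Linking [y] with [z] covers [y] and exposes at most [g z]; unless [g z] is a newly exposed
    neighbour of [x], this contradicts the minimality of [g]. *)
Lemma optimal_exchange f x g y z : is_matching f -> optimal f x g ->
  adj x y -> g y = y -> adj y z -> z != x -> f z = z ->
  g z != z /\ adj x (g z).
Proof.
move=> fM [fg gx ming] xy gy yz zx fz.
have fy := extends_fixed fg gy.
have fl : extends f (link g y z) by apply: link_extends.
have xy' := adj_neq xy.
have lx : link g y z x = x.
  by apply/eqP; rewrite link_fixed // gx eqxx xy' eq_sym zx.
apply/andP; apply: contraLR (ming _ fl lx) => nH.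
rewrite -ltnNge; apply: proper_card; apply/properP; split; last first.
  by exists y; rewrite !inE ?xy ?gy ?eqxx // link_fixed // eqxx.
apply/subsetP=> t; rewrite !inE link_fixed // => /and4P[xt tny tnz].
rewrite xt /= gy (negbTE tny) /=; case/orP=> // /eqP tz.
by move: nH; rewrite -tz xt andbT tnz.
Qed.

(** By the exchange, [g] maps the [f]-free neighbours of [y] other than [x] injectively to those of
    [x] other than [y]. *)
Lemma optimal_free_deg f x g y : is_matching f -> optimal f x g ->
  adj x y -> g y = y -> free_deg f y <= free_deg f x.
Proof.
move=> fM og xy gy; have [fg gx _] := og; have [gM _] := fg.
have [gK _] := is_matchingP _ gM.
have fx := extends_fixed fg gx; have fy := extends_fixed fg gy.
rewrite /free_deg (cardsD1 x) (cardsD1 y (nbhd x :&: _)).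
rewrite !inE adj_sym xy fx fy !eqxx /= leq_add2l.
rewrite -(card_imset _ (inv_inj gK)); apply: subset_leq_card.
apply/subsetP=> t /imsetP[z zD ->]; move: zD.
rewrite !inE => /and3P[zx yz /eqP fz].
have [gz ->] := optimal_exchange fM og xy gy yz zx fz.
rewrite (extends_free fM fg fz) eqxx !andbT.
by apply: contra gz => /eqP e; rewrite -{2}(gK z) e gy.
Qed.

(* [half_pair f g x y]: [g] witnesses that [y] is the only obstruction to leaving [x] unmatched. *)
Definition half_pair f g x y :=
  [/\ extends f g, adj x y, g x = x, g y = y &
      forall w, adj x w -> g w = w -> w = y].

(** A stuck vertex always keeps at least one free neighbour, so a single one is the minimum. *)
Lemma half_pair_optimal f g x y :
  stuck f x -> half_pair f g x y -> optimal f x g.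
Proof.
move=> [_ st] [fg xy gx gy uniq_y]; split=> // h fh hx.
have [t xt ht] := st h fh hx.
apply: (@leq_trans 1); last by apply/card_gt0P; exists t; rewrite !inE xt ht eqxx.
rewrite -(cards1 y); apply: subset_leq_card; apply/subsetP=> w.
by rewrite !inE => /andP[xw /eqP gw]; rewrite (uniq_y w).
Qed.

Lemma optimal_half_pair f g x y : is_matching f ->
  optimal f x g -> adj x y -> g y = y -> half_pair f g y x.
Proof.
move=> fM og xy gy; have [fg gx _] := og.
split=> //; first by rewrite adj_sym.
move=> w yw gw; apply/eqP; case: (eqVneq w x) => // wx.
have [] := optimal_exchange fM og xy gy yw wx (extends_fixed fg gw).
by rewrite gw eqxx.
Qed.

(** Moving along the alternating path from [y] through [z] shifts the only obstruction from [y] to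
    [g z]. *)
Lemma half_pair_link f g x y z : is_matching f -> stuck f x -> half_pair f g x y ->
  adj y z -> z != x -> f z = z -> half_pair f (link g y z) x (g z).
Proof.
move=> fM st hp yz zx fz.
have [fg xy gx gy uniq_y] := hp; have [gM _] := fg.
have [gK _] := is_matchingP _ gM.
have og := half_pair_optimal st hp.
have [gz xgz] := optimal_exchange fM og xy gy yz zx fz.
have fy := extends_fixed fg gy.
split=> //; first exact: link_extends.
- by apply/eqP; rewrite link_fixed // gx eqxx (adj_neq xy) eq_sym zx.
- apply/eqP; rewrite link_fixed // eqxx gz !orbT !andbT.
  by apply: contra gz => /eqP e; rewrite -{2}(gK z) e gy.
move=> w xw /eqP; rewrite link_fixed // => /and3P[wy wz].
rewrite gy (negbTE wy) /=; case/orP=> /eqP // /uniq_y e.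
by move: wy; rewrite e ?eqxx.
Qed.

Section AllStuck.
Variables (f : {ffun G -> G}) (k : nat).
Hypothesis fM : is_matching f.
Hypothesis stuckP : forall x, f x = x -> 0 < free_deg f x <= k -> stuck f x.

(** The obstruction [y] found for [x] has free degree at most that of [x], hence is stuck too, which
    makes the relation symmetric. *)
Lemma pair_exists x : f x = x -> 0 < free_deg f x <= k ->
  exists g y, [/\ half_pair f g x y, half_pair f g y x, stuck f x & stuck f y].
Proof.
move=> fx kx; have st := stuckP fx kx.
have [g og] := optimal_exists fM fx; have [fg gx _] := og.
have [y xy gy] := st.2 g fg gx.
have fy := extends_fixed fg gy.
have ky : 0 < free_deg f y <= k.
  rewrite (leq_trans (optimal_free_deg fM og xy gy)) ?andbT; last by case/andP: kx.
  by apply/card_gt0P; exists x; rewrite !inE adj_sym xy fx eqxx.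
have sty := stuckP fy ky.
have hyx := optimal_half_pair fM og xy gy.
exists g, y; split=> //.
by apply: optimal_half_pair (half_pair_optimal sty hyx) _ gx => //; rewrite adj_sym.
Qed.

(** The exchange seen from [y] along the edge [xw] gives that [y] is adjacent to [g w]; linking
    these two then makes [w] the only obstruction for [x]. *)
Lemma pair_reach g x y w : half_pair f g x y -> half_pair f g y x ->
  stuck f x -> stuck f y -> adj x w -> f w = w -> w != y ->
  [/\ adj y (g w), g w != x & half_pair f (link g y (g w)) x w].
Proof.
move=> hxy hyx stx sty xw fw wy.
have [fg xy gx gy _] := hxy; have [gM _] := fg.
have [gK _] := is_matchingP _ gM.
have yx : adj y x by rewrite adj_sym.
have [gw ygw] := optimal_exchange fM (half_pair_optimal sty hyx) yx gx xw wy fw.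
have gwx : g w != x.
  by apply: contraTneq xw => e; rewrite -(gK w) e gx adj_irr.
split=> //; rewrite -{2}(gK w); apply: half_pair_link => //.
exact: extends_free fg fw.
Qed.

(** Any free neighbour of [x] can be made its only obstruction, so the comparison of free degrees
    holds for all of them. *)
Lemma free_deg_nbhd x w : f x = x -> free_deg f x <= k ->
  adj x w -> f w = w -> free_deg f w <= free_deg f x.
Proof.
move=> fx kx xw fw.
have kx' : 0 < free_deg f x <= k.
  by rewrite kx andbT; apply/card_gt0P; exists w; rewrite !inE xw fw eqxx.
have [g [y [hxy hyx stx sty]]] := pair_exists fx kx'.
have [fg xy gx gy _] := hxy.
case: (eqVneq w y) => [->|wy].
  exact: optimal_free_deg (half_pair_optimal stx hxy) xy gy.
have [_ _ hw] := pair_reach hxy hyx stx sty xw fw wy.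
have [_ _ _ lw _] := hw.
exact: optimal_free_deg (half_pair_optimal stx hw) xw lw.
Qed.

End AllStuck.
End Exchange.

Lemma sum_eq1 (T : finType) (A : {set T}) (F : T -> nat) :
  {in A, forall x, 0 < F x} -> \sum_(x in A) F x <= #|A| ->
  {in A, forall x, F x = 1}.
Proof.
move=> F0 le x xA; apply/eqP; rewrite eqn_leq F0 // andbT.
have : \sum_(i in A :\ x) 1 <= \sum_(i in A :\ x) F i.
  by apply: leq_sum => i; rewrite !inE => /andP[_ /F0].
move: le; rewrite sum1_card (big_setD1 x xA) (cardsD1 x A) xA /=; lia.
Qed.

(** * Greedy growth of the set [I] and its matching *)

Section Configurations.
Variables (G : sgraph) (d : nat).
Hypothesis reg : regular d G.
Implicit Types (f g h : {ffun G -> G}) (x y z u v w : G) (A B I : {set G}).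

Definition deg x A := #|nbhd x :&: A|.

Lemma degE x A : deg x A = \sum_(y in A) adj x y.
Proof.
rewrite /deg -sum1_card big_mkcond [RHS]big_mkcond /=; apply: eq_bigr => y _.
by rewrite !inE; case: adj; case: (y \in A).
Qed.

Lemma deg_exchange A B : \sum_(x in A) deg x B = \sum_(y in B) deg y A.
Proof.
under eq_bigr do rewrite degE; under [RHS]eq_bigr do rewrite degE.
by rewrite exchange_big /=; do 2!apply: eq_bigr => ? _; rewrite adj_sym.
Qed.

Lemma deg_setT x : deg x setT = d.
Proof. by rewrite /deg setIT; apply: reg. Qed.

Lemma deg_setID x A B : deg x (A :&: B) + deg x (A :\: B) = deg x A.
Proof. by rewrite /deg setIA setIDA cardsID. Qed.

Lemma deg_le x A : deg x A <= d.
Proof. by rewrite -(deg_setT x); apply/subset_leq_card/setIS/subsetT. Qed.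

Lemma deg_gt0 x y A : adj x y -> y \in A -> 0 < deg x A.
Proof. by move=> xy yA; apply/card_gt0P; exists y; rewrite !inE xy. Qed.

Lemma deg_eq0P x A : reflect (forall y, adj x y -> y \notin A) (deg x A == 0).
Proof.
rewrite cards_eq0; apply: (iffP eqP) => [e y xy|nA].
  by move/setP/(_ y): e; rewrite !inE xy /= => ->.
by apply/setP=> y; rewrite !inE; case: (boolP (adj x y)) => //= /nA/negbTE.
Qed.

(* The bound on the matched vertices is the one obtained by adding vertices to
   [I] one at a time, each but the first adjacent to an already matched vertex. *)
Record config f I : Prop := Config {
  config_matching : is_matching f;
  config_fixed : forall x, x \in I -> f x = x;
  config_nbr : forall x y, x \in I -> adj x y -> f y != y;
  config_touch : forall x, f x != x ->
    exists2 u, u \in I & adj u x || adj u (f x);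
  config_card : #|~: fixed f| <= 2 * ((d - 1) * #|I| + 1) }.

Lemma max_config : exists f I, config f I /\
  forall g J, config g J -> #|J| <= #|I|.
Proof.
pose P (p : {ffun G -> G} * {set G}) :=
  [&& is_matching p.1, [forall x in p.2, p.1 x == x],
      [forall x in p.2, forall y, adj x y ==> (p.1 y != y)],
      [forall x, (p.1 x != x) ==> [exists u in p.2, adj u x || adj u (p.1 x)]] &
      #|~: fixed p.1| <= 2 * ((d - 1) * #|p.2| + 1)].
have PE p : reflect (config p.1 p.2) (P p).
  case: p => f I; apply: (iffP and5P) => /= [[fM fI fN fT fC]|[fM fI fN fT fC]]; split=> //.
  - by move=> x xI; apply/eqP/(forall_inP fI).
  - by move=> x y xI xy; move: (forall_inP fN x xI) => /forallP/(_ y); rewrite xy.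
  - move=> x fx; have /exists_inP[u uI] := implyP (forallP fT x) fx.
    by exists u.
  - by apply/forall_inP=> x /fI ->.
  - by apply/forall_inP=> x xI; apply/forallP=> y; apply/implyP; apply: fN.
  - by apply/forallP=> x; apply/implyP=> /fT[u uI uP]; apply/exists_inP; exists u.
have P0 : P ([ffun x => x], set0).
  apply/PE; split=> /=.
  - by apply/is_matchingP; split=> x; rewrite !ffunE // eqxx.
  - by move=> x; rewrite inE.
  - by move=> x y; rewrite inE.
  - by move=> x; rewrite ffunE eqxx.
  - rewrite (_ : ~: _ = set0) ?cards0 //; apply/setP=> x.
    by rewrite !inE ffunE eqxx.
case: (arg_maxnP (fun p : {ffun G -> G} * {set G} => #|p.2|) P0) => -[f I] /PE /= fI maxI.
by exists f, I; split=> // g J gJ; apply: (maxI (g, J)); apply/PE.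
Qed.

Lemma config_deg0 f I x : config f I -> x \in I -> free_deg f x = 0.
Proof.
move=> fI xI; apply/eqP/deg_eq0P => y xy; rewrite inE.
exact: config_nbr fI _ _ xI xy.
Qed.

Lemma config_set0 f I x : config f I -> I = set0 -> f x = x.
Proof.
move=> fI I0; apply/eqP/negP => /negP /(config_touch fI)[u].
by rewrite I0 inE.
Qed.

Lemma config_extend f I g x : 0 < d -> config f I -> f x = x -> x \notin I ->
  extends f g -> g x = x -> (forall y, adj x y -> g y != y) ->
  free_deg f x <= d - 1 \/ I = set0 -> exists h, config h (x |: I).
Proof.
move=> d0 fI fx xI fg gx gN few; have [gM fgE] := fg.
have fM := config_matching fI.
have [gK gadj] := is_matchingP _ gM.
(* Of [g], only the edges of [f] and the edges meeting the neighbourhood of [x] are kept, so that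
   few vertices become matched. *)
pose c z := [|| f z != z, adj x z | adj x (g z)].
have cg z : c (g z) = c z.
  rewrite /c gK orbCA [in RHS]orbCA orbC [in RHS]orbC -!orbA orbC [in RHS]orbC.
  suff -> : (f (g z) != g z) = (f z != z) by case: adj; case: adj; case: eqP.
  case: (boolP (f z == z)) => [/eqP fz|fz].
    by rewrite (extends_free fM fg fz) eqxx.
  have [fK _] := is_matchingP _ fM.
  by rewrite (fgE z fz) fK eq_sym fz.
pose h := [ffun z => if c z then g z else z].
exists h; have hc z : h z != z -> c z /\ h z = g z.
  by rewrite ffunE; case: ifP => //; rewrite eqxx.
have hf z : f z != z -> h z != z.
  by move=> fz; rewrite ffunE /c fz /= fgE.
split.
- apply/is_matchingP; split=> z.
    by rewrite !ffunE; case: (boolP (c z)) => [cz|/negbTE->//]; rewrite cg cz gK.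
  by rewrite ffunE; case: ifP => [_ /gadj //|]; rewrite eqxx.
- move=> z; rewrite !inE ffunE => /orP[/eqP->|zI]; first by rewrite gx if_same.
  suff -> : g z = z by rewrite if_same.
  apply/eqP/negP => /negP gz; have zgz := gadj _ gz.
  have := config_nbr fI zI zgz.
  by rewrite (extends_free fM fg (config_fixed fI zI)) eqxx.
- move=> z y; rewrite !inE => /orP[/eqP->|zI] zy.
    by rewrite ffunE /c zy orbT gN.
  exact: hf (config_nbr fI zI zy).
- move=> z hz; have [cz hzE] := hc z hz; rewrite hzE.
  case/or3P: (cz) => [fz|xz|xz].
  + have [u uI uz] := config_touch fI fz; exists u; first by rewrite inE uI orbT.
    by rewrite fgE.
  + by exists x; rewrite ?setU11 ?xz.
  + by exists x; rewrite ?setU11 ?xz ?orbT.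
(* The newly matched vertices lie in [A] or are partners of [A]: at most [2 * (d - 1)] in general,
   and at most [2 * d] for the first vertex, which the summand 1 in [config_card] allows. *)
pose A := nbhd x :&: fixed f.
have sub : ~: fixed h \subset ~: fixed f :|: (A :|: g @: A).
  apply/subsetP=> z; rewrite !inE => hz; have [cz _] := hc z hz.
  case: (boolP (f z == z)) => [fz|//]; move: (fz) => /eqP fz'.
  case/or3P: cz => [|->//|xgz]; first by rewrite fz.
  apply/orP; right; apply/orP; right; apply/imsetP; exists (g z); rewrite ?gK //.
  by rewrite !inE xgz (extends_free fM fg fz') eqxx.
have := subset_leq_card sub.
have := (leq_card_setU (~: fixed f) (A :|: g @: A)).1.
have := (leq_card_setU A (g @: A)).1.
have := leq_imset_card g A.
rewrite cardsU1 xI !mulnDr !muln1; have := config_card fI.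
have : #|A| <= d by apply: deg_le.
case: few => [leA|I0]; first by move: leA; rewrite /free_deg -/A; lia.
have -> : ~: fixed f = set0.
  by apply/setP=> z; rewrite !inE (config_set0 _ fI I0) eqxx.
by rewrite I0 !cards0 muln0; lia.
Qed.

(** A vertex that is not stuck could be added to [I], against maximality. The first vertex may have
    any free degree, later ones at most [d - 1]. *)
Lemma max_config_stuck f I k : 0 < d -> config f I ->
  (forall g J, config g J -> #|J| <= #|I|) -> (I != set0 -> k <= d - 1) ->
  forall x, f x = x -> 0 < free_deg f x <= k -> stuck f x.
Proof.
move=> d0 fI maxI kd x fx /andP[x0 xk]; split=> // g fg gx.
case: (boolP [exists y, adj x y && (g y == y)]).
  by case/existsP=> y /andP[xy /eqP gy]; exists y.
rewrite negb_exists => /forallP gN.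
have xI : x \notin I by apply: contraL x0 => /(config_deg0 fI)->.
have [||h hI] := config_extend d0 fI fx xI fg gx.
- by move=> y xy; move: (gN y); rewrite xy.
- by case: (eqVneq I set0) => [|/kd kd']; [right | left; apply: leq_trans kd'].
by have := maxI _ _ hI; rewrite cardsU1 xI ltnn.
Qed.

Lemma max_config_covered f I : 0 < d -> connected G -> config f I ->
  (forall g J, config g J -> #|J| <= #|I|) -> I != set0 ->
  forall x, f x = x -> x \notin I -> 0 < deg x (~: fixed f).
Proof.
move=> d0 [_ Gc] fI maxI I0 x fx xI.
have fM := config_matching fI.
have stuckP := max_config_stuck d0 fI maxI (fun _ => leqnn (d - 1)).
have degS y : deg y (~: fixed f) = d - free_deg f y.
  by rewrite -(deg_setT y) -(deg_setID y setT (fixed f)) setTI setTD addKn.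
rewrite lt0n; apply/negP => x0.
(* [B] is closed under adjacency: a neighbour [z] of [y] in [B] that touches a matched vertex has
   free degree below [d], which bounds that of [y], although [y] has free degree [d]. Connectivity
   would then put [I] inside [B]. *)
pose B : {set G} := [set y | [&& f y == y, y \notin I & deg y (~: fixed f) == 0]].
have BP y z : adj y z -> y \in B -> z \in B.
  rewrite !inE => yz /and3P[/eqP fy yI y0].
  have zy : adj z y by rewrite adj_sym.
  have fz : f z = z by move/deg_eq0P: y0 => /(_ z yz); rewrite !inE negbK => /eqP.
  have zI : z \notin I.
    by apply/negP=> zI; have := config_nbr fI zI zy; rewrite fy eqxx.
  rewrite fz eqxx zI /=; move: y0; rewrite !degS !subn_eq0 => y0.
  rewrite leqNgt; apply/negP=> zd.
  have kz : free_deg f z <= d - 1 by lia.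
  by have := free_deg_nbhd fM stuckP fz kz zy fy; lia.
have [u uI] := set0Pn _ I0.
have Bc : closed (@adj G) (mem B).
  by apply: intro_closed BP; apply: sym_connect_sym; apply: adj_sym.
have := closed_connect Bc (Gc x u).
by rewrite /= !inE fx eqxx xI x0 uI /= andbF.
Qed.
End Configurations.

(** * Fixed points of a rematching, and independent sets *)

Section Linking.
Variable G : sgraph.
Implicit Types (f g h F : {ffun G -> G}) (x y z u v w : G) (A B I : {set G}).

Lemma link_id f q r x : x != q -> x != r -> x != f q -> x != f r ->
  link f q r x = f x.
Proof. by move=> xq xr xfq xfr; rewrite ffunE !ifN // negb_or xfq. Qed.

Lemma link_left f q r : link f q r q = r.
Proof. by rewrite ffunE eqxx. Qed.

Lemma fixed_link f q r : adj q r ->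
  fixed (link f q r) = (f q |: (f r |: fixed f)) :\: [set q; r].
Proof.
move=> qr; apply/setP=> x; rewrite !inE link_fixed // negb_or -andbA.
by do 2!case: (x == _) => //=; case: (x == _); case: (x == _); case: (_ == _).
Qed.

Lemma independent_setU1 x A : independent A -> (forall y, y \in A -> ~~ adj x y) ->
  independent (x |: A).
Proof.
move=> Ai xA y z; rewrite !inE => /orP[/eqP->|yA] /orP[/eqP->|zA].
- by rewrite adj_irr.
- exact: xA.
- by rewrite adj_sym xA.
- exact: Ai.
Qed.

End Linking.

(** Here [a], [s], [t] are the sizes of [I], [S], [T], and [X], [Y] count degrees into [S] from [S]
    and [T]. Then [n <= d * s - (d - 1) * a], which by the bound on [s] is at most the lower bound
    on [n], so every inequality is an equality. *)
Lemma tight_arith d a b s t X Y n : 0 < d ->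
  (d - 1) * (2 * d - 1) * b + 2 * d <= n -> a <= b -> s <= X -> t <= Y ->
  d * s = d * a + X + Y -> s <= 2 * ((d - 1) * a + 1) -> n = a + s + t ->
  [/\ X <= s, Y <= t, s = 2 * ((d - 1) * a + 1) &
      n = (d - 1) * (2 * d - 1) * a + 2 * d].
Proof.
case: d => // e _; have [-> ->] : e.+1 - 1 = e /\ 2 * e.+1 - 1 = 2 * e + 1 by lia.
move=> K1 ab sX tY sumS cS nE.
have K2 := leq_mul (leqnn (e * (2 * e + 1))) ab.
have Ka : e * (2 * e + 1) * a = 2 * (e * (e * a)) + e * a.
  by rewrite mulnDr muln1 mulnDl mulnCA -!mulnA.
have M := leq_mul (leqnn e.+1) cS.
have M1 : e.+1 * (2 * (e * a + 1)) = 2 * (e * (e * a)) + 2 * e + 2 * (e * a) + 2.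
  by rewrite mulSn !mulnDr mulnCA; lia.
rewrite Ka in K2 *; rewrite !mulSn in sumS M M1 *.
move: K1 K2 sumS M M1 cS nE.
move: (e * (2 * e + 1) * b) (e * (e * a)) (e * a) => kb q p.
move=> K1 K2 sumS M M1 cS nE.
have E : s = 2 * (p + 1).
  apply/eqP; rewrite eqn_leq cS /= -(leq_pmul2l (ltn0Sn e)) !mulSn M1.
  by lia.
subst s; split; lia.
Qed.

(** * The tight case with [I] nonempty is contradictory *)

Section Tight.
Variables (G : sgraph) (d : nat).
Hypotheses (d3 : 3 <= d) (reg : regular d G).
Implicit Types (g h F : {ffun G -> G}) (x y z u v w : G) (A B : {set G}).
Variables (f : {ffun G -> G}) (I : {set G}).
Hypothesis fI : config d f I.
Hypothesis cov : forall x, f x = x -> x \notin I -> 0 < deg x (~: fixed f).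
Hypothesis large : forall g, is_matching g -> independent (fixed g) ->
  (d - 1) * (2 * d - 1) * #|fixed g| + 2 * d <= #|G|.

Let S : {set G} := ~: fixed f.
Let T : {set G} := fixed f :\: I.

Let fM : is_matching f := config_matching fI.
Let fK : involutive f := (is_matchingP _ fM).1.
Let fadj x : f x != x -> adj x (f x) := (is_matchingP _ fM).2 x.

Let inS x : (x \in S) = (f x != x). Proof. by rewrite !inE. Qed.
Let inT x : (x \in T) = (x \notin I) && (f x == x). Proof. by rewrite !inE. Qed.

Let fS x : (f x \in S) = (x \in S).
Proof. by rewrite !inS fK eq_sym. Qed.

Let I_fixed : I \subset fixed f.
Proof. by apply/subsetP=> x /(config_fixed fI) fx; rewrite inE fx. Qed.

Let deg_split x : deg x I + deg x S + deg x T = d.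
Proof.
have := deg_setID x setT (fixed f); rewrite setTI setTD (deg_setT reg).
by have := deg_setID x (fixed f) I; rewrite (setIidPr I_fixed); rewrite /S /T; lia.
Qed.

Let nbrI x y : x \in I -> adj x y -> y \in S.
Proof. by rewrite inS; apply: (config_nbr fI). Qed.

Let degI_S x : x \in I -> deg x S = d.
Proof.
move=> xI; have := deg_split x.
have -> : deg x I = 0.
  by apply/eqP/deg_eq0P => y /(nbrI xI); apply: contraL => /(config_fixed fI) fy; rewrite inS fy eqxx.
have -> : deg x T = 0.
  by apply/eqP/deg_eq0P => y /(nbrI xI); rewrite inS inT negb_and orbC => ->.
lia.
Qed.

Let sum_SI : \sum_(x in S) deg x I = d * #|I|.
Proof.
rewrite deg_exchange mulnC -sum_nat_const; apply: eq_bigr => x xI.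
exact: degI_S.
Qed.

Let degS_gt0 x : x \in S -> 0 < deg x S.
Proof. by move=> xS; apply: (@deg_gt0 _ x (f x)); rewrite ?fS //; apply: fadj; rewrite -inS. Qed.

Let degT_gt0 x : x \in T -> 0 < deg x S.
Proof. by rewrite inT => /andP[xI /eqP fx]; apply: cov. Qed.

Let extends_I g : extends f g -> I \subset fixed g.
Proof.
move=> fg; have [gM _] := fg; apply/subsetP=> x xI; rewrite inE.
apply/negP => /negP gx; have := nbrI xI ((is_matchingP _ gM).2 x gx).
by rewrite inS (extends_free fM fg (config_fixed fI xI)) eqxx.
Qed.

Let card_G : #|G| = #|I| + #|S| + #|T|.
Proof.
have := cardsC (fixed f); rewrite -/S.
by have := cardsID I (fixed f); rewrite (setIidPr I_fixed) -/T; lia.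
Qed.

Let tight : [/\ \sum_(x in S) deg x S <= #|S|, \sum_(x in T) deg x S <= #|T|,
   #|S| = 2 * ((d - 1) * #|I| + 1) &
   #|G| = (d - 1) * (2 * d - 1) * #|I| + 2 * d].
Proof.
have [g fg gi] := maximal_extension fM.
have S1 : #|S| <= \sum_(x in S) deg x S.
  by rewrite -sum1_card; apply: leq_sum => x /degS_gt0.
have T1 : #|T| <= \sum_(x in T) deg x S.
  by rewrite -sum1_card; apply: leq_sum => x /degT_gt0.
have sumS : d * #|S| = d * #|I| + \sum_(x in S) deg x S + \sum_(x in T) deg x S.
  rewrite -sum_SI [X in _ + X]deg_exchange -!big_split /= mulnC -sum_nat_const.
  by apply: eq_bigr => x _; rewrite deg_split.
have := large fg.1 gi; have := subset_leq_card (extends_I fg).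
have := config_card fI; have := card_G; move: S1 T1 sumS; rewrite -/S.
by move=> S1 T1 sumS nE cS ab K1; apply: tight_arith (ltnW (ltnW d3)) K1 ab S1 T1 sumS cS nE.
Qed.

Let degS1 x : x \in S -> deg x S = 1.
Proof. by have [H _ _ _] := tight; apply: (sum_eq1 degS_gt0 H). Qed.

Let degT1 x : x \in T -> deg x S = 1.
Proof. by have [_ H _ _] := tight; apply: (sum_eq1 degT_gt0 H). Qed.

Let uniqS x y z : deg x S = 1 -> y \in S -> z \in S -> adj x y -> adj x z -> y = z.
Proof.
move=> /eqP/cards1P[t e] yS zS xy xz.
have: y \in [set t] by rewrite -e !inE xy -inS.
have: z \in [set t] by rewrite -e !inE xz -inS.
by rewrite !inE => /eqP-> /eqP->.
Qed.

Let degT_I x : x \in T -> deg x I = 0.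
Proof.
rewrite inT => /andP[_ fx]; apply/eqP/deg_eq0P => y xy; apply/negP=> yI.
by have := nbrI yI; move/(_ x); rewrite adj_sym xy inS fx => /(_ isT).
Qed.

Let degT_T x : x \in T -> deg x T = d - 1.
Proof. by move=> xT; have := deg_split x; rewrite degT1 // degT_I //; lia. Qed.

Let max_fixed h : is_matching h -> independent (fixed h) -> #|fixed h| <= #|I|.
Proof.
move=> hM hi; have := large hM hi; have [_ _ _ ->] := tight.
by rewrite leq_add2r leq_pmul2l // muln_gt0; lia.
Qed.

(** A maximal extension misses all of [I], and by [max_fixed] nothing more. *)
Let perfect g : extends f g -> exists2 F, extends g F & fixed F = I.
Proof.
move=> fg; have [F gF Fi] := maximal_extension fg.1; exists F => //.
apply/esym/eqP; rewrite eqEcard extends_I ?max_fixed //; first exact: gF.1.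
exact: extends_trans gF.
Qed.

Let indepI : independent I.
Proof.
move=> x y xI yI; apply/negP => /(nbrI xI).
by rewrite inS (config_fixed fI yI) eqxx.
Qed.

Let nadjI x : deg x I = 0 -> forall y, y \in I -> ~~ adj x y.
Proof. by move=> /eqP/deg_eq0P H y; apply: contraL => /H. Qed.

(** Otherwise linking [q] with [r] would leave [I] and the two partners unmatched, an independent
    set of [#|I| + 2] vertices. *)
Let no_gain F q r : is_matching F -> fixed F = I -> adj q r ->
  q \notin I -> r \notin I -> F q != r ->
  deg (F q) I = 0 -> deg (F r) I = 0 -> adj (F q) (F r).
Proof.
move=> FM FI qr qI rI Fqr dq dr; have [FK _] := is_matchingP _ FM.
have Fq : F q != q by move: qI; rewrite -FI inE.
have Fr : F r != r by move: rI; rewrite -FI inE.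
apply/negPn/negP => nadj.
have E : fixed (link F q r) = F q |: (F r |: I).
  rewrite fixed_link // FI; apply/setDidPl; rewrite disjoint_sym.
  apply/pred0P => x /=; rewrite !inE; apply/andP=> -[/orP[]/eqP-> /or3P[]] //.
  - by rewrite eq_sym (negbTE Fq).
  - by rewrite eq_sym (inv_eq FK) eq_sym (negbTE Fqr).
  - by rewrite (negbTE qI).
  - by rewrite eq_sym (negbTE Fqr).
  - by rewrite eq_sym (negbTE Fr).
  - by rewrite (negbTE rI).
have nI x : F x != x -> F x \notin I by move=> Fx; rewrite -FI inE FK eq_sym.
have Ai : independent (F q |: (F r |: I)).
  apply: independent_setU1; first by apply: independent_setU1 => //; apply: nadjI.
  by move=> y; rewrite !inE => /orP[/eqP->|/(nadjI dq)].
have := max_fixed (link_matching FM qr); rewrite E => /(_ Ai).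
rewrite !cardsU1 !inE (inj_eq (inv_inj FK)) (negbTE (adj_neq qr)) !nI //=.
by rewrite !add1n ltnNge leqnSn.
Qed.

Let inT_notS x : x \in T -> x \notin S.
Proof. by rewrite inT inS => /andP[_ ->]. Qed.

Let neqTS x y : x \in T -> y \in S -> x != y.
Proof. by move=> xT; apply: contraTneq => <-; apply: inT_notS. Qed.

Let fixT x : x \in T -> f x = x.
Proof. by rewrite inT => /andP[_ /eqP]. Qed.

Let notI_T x : x \in T -> x \notin I.
Proof. by rewrite inT => /andP[]. Qed.

Let notI_S x : x \in S -> x \notin I.
Proof. by rewrite inS; apply: contra => /(config_fixed fI)->. Qed.

(** With [pq] and [rs] in a matching that misses only [I], rematching [q] with [r] exposes [p] and
    [s], so [no_gain] applies. *)
Let path4 p q r s : p \in T -> q \in T -> r \in T -> s \in T ->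
  adj p q -> adj q r -> adj r s -> p != r -> p != s -> q != s -> adj p s.
Proof.
move=> pT qT rT sT pq qr rs pr ps qs.
have e1 : extends f (link f p q) by apply: link_extends; rewrite ?fixT.
have e2 : extends f (link (link f p q) r s) by apply: link_extends; rewrite ?fixT.
have [F [FM gF] FI] := perfect e2.
have [FK _] := is_matchingP _ FM.
have lr : link f p q r = r by rewrite link_id ?fixT // eq_sym // adj_neq.
have ls : link f p q s = s by rewrite link_id ?fixT // eq_sym // adj_neq.
have Fp : F p = q.
  have lp : link (link f p q) r s p = q.
    by rewrite link_id ?lr ?ls ?link_left.
  by rewrite gF ?lp // eq_sym adj_neq.
have Fr : F r = s by rewrite gF link_left // eq_sym adj_neq.
have Fq : F q = p by rewrite -Fp FK.
rewrite -Fq -Fr; apply: no_gain => //.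
- exact: notI_T.
- exact: notI_T.
- by rewrite Fq.
- by rewrite Fq degT_I.
- by rewrite Fr degT_I.
Qed.

Let leaf v := [&& v \in S, deg v I == 1 & deg (f v) I == 0].

Let leafP v : leaf v -> [/\ v \in S, f v \in S, deg v I = 1 & deg (f v) I = 0].
Proof. by case/and3P=> vS /eqP-> /eqP->; rewrite fS. Qed.

(** With [ab] in the matching, rematching [v] with [a] exposes [f v] and [b], neither of which has a
    neighbour in [I]. *)
Let leaf_square v a b : leaf v -> a \in T -> adj v a -> b \in T -> adj a b ->
  adj (f v) b.
Proof.
move=> /leafP[vS wS v1 w0] aT va bT ab.
have e1 : extends f (link f a b) by apply: link_extends; rewrite ?fixT.
have [F [FM gF] FI] := perfect e1.
have fv : f v != v by rewrite -inS.
have Fv : F v = f v by have [_ e] := extends_trans e1 (conj FM gF); rewrite e.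
have Fa : F a = b by rewrite gF link_left // eq_sym adj_neq.
rewrite -Fv -Fa; apply: no_gain => //.
- exact: notI_S.
- exact: notI_T.
- by rewrite Fv eq_sym neqTS.
- by rewrite Fv.
- by rewrite Fa degT_I.
Qed.

Let degw_T v : leaf v -> deg (f v) T = d - 1.
Proof.
by move=> /leafP[_ wS _ w0]; have := deg_split (f v); rewrite w0 (degS1 wS); lia.
Qed.

Let degv_T v : leaf v -> deg v T = d - 2.
Proof.
by move=> /leafP[vS _ v1 _]; have := deg_split v; rewrite v1 (degS1 vS); lia.
Qed.

Let deg_sub x y A : deg x A = deg y A ->
  (forall z, z \in A -> adj x z -> adj y z) -> forall z, z \in A -> adj y z -> adj x z.
Proof.
move=> e sub z zA yz.
have /eqP E : nbhd x :&: A == nbhd y :&: A.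
  rewrite eqEcard -/(deg x A) -/(deg y A) e leqnn andbT.
  by apply/subsetP=> t; rewrite !inE => /andP[xt tA]; rewrite sub.
by have := in_setI z (nbhd y) A; rewrite -E !inE zA yz andbT => ->.
Qed.

(** By [leaf_square] the neighbours of [a] in [T] are neighbours of [f v]; both vertices have
    [d - 1] of them, so the two sets agree. *)
Let leaf_eq v a b : leaf v -> a \in T -> adj v a -> b \in T -> adj (f v) b ->
  adj a b.
Proof.
move=> lv aT va bT wb; apply: (@deg_sub a (f v) T) => //.
  by rewrite degT_T // degw_T.
by move=> z zT az; apply: leaf_square az.
Qed.

Let many_leaves : #|I| < #|[set v | leaf v]|.
Proof.
set L := [set v | leaf v].
(* Each edge of [f] has total weight at least 2: it sends an edge to [I], and if only one, then an
   endpoint is a leaf. Summing gives [#|S| <= d * #|I| + #|L|], hence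
   [#|L| >= (d - 2) * #|I| + 2]. *)
pose phi v := deg v I + (v \in L).
have pair v : v \in S -> 2 <= phi v + phi (f v).
  move=> vS; rewrite /phi !inE /leaf fS vS fK /=.
  have : 0 < deg v I + deg (f v) I.
    have [|u uI /orP[]] := config_touch fI (x := v); first by rewrite -inS.
      by rewrite adj_sym => vu; rewrite addn_gt0 (deg_gt0 vu uI).
    by rewrite adj_sym => vu; rewrite addn_gt0 (deg_gt0 vu uI) orbT.
  by case: (deg v I) => [|[|p]]; case: (deg (f v) I) => [|[|q]] //= _; lia.
have sumf : \sum_(v in S) phi (f v) = \sum_(v in S) phi v.
  by rewrite [RHS](reindex_inj (inv_inj fK)); apply: eq_bigl => v; rewrite fS.
have : \sum_(v in S) 2 <= \sum_(v in S) (phi v + phi (f v)) by apply: leq_sum.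
rewrite big_split /= sumf sum_nat_const.
have -> : \sum_(v in S) phi v = d * #|I| + #|L|.
  rewrite big_split /= sum_SI; congr (_ + _).
  rewrite -sum1_card big_mkcond [RHS]big_mkcond /=; apply: eq_bigr => v _.
  have -> : (v \in L) = leaf v by rewrite inE.
  by rewrite /leaf; case: (v \in S) => //=; case: (_ && _).
have [_ _ -> _] := tight.
have : d * #|I| = (d - 1) * #|I| + #|I| by rewrite mulnBl mul1n subnK // leq_pmull; lia.
have : 2 * #|I| <= (d - 1) * #|I| by rewrite leq_mul2r; lia.
lia.
Qed.

Let two_leaves : exists u v1 v2,
  [/\ u \in I, leaf v1, leaf v2, v1 != v2 & adj u v1 /\ adj u v2].
Proof.
set L := [set v | leaf v].
have sumL : \sum_(u in I) deg u L = #|L|.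
  rewrite deg_exchange -sum1_card; apply: eq_bigr => v.
  by rewrite inE => /leafP[_ _ ->].
case: (boolP [exists u in I, 1 < deg u L]) => [/exists_inP[u uI]|/exists_inPn H].
  case/card_gt1P=> v1 [v2 []]; rewrite !inE => /andP[uv1 l1] /andP[uv2 l2] v12.
  by exists u, v1, v2.
have := many_leaves; rewrite -/L -sumL -sum1_card ltnNge => /negP[].
by apply: leq_sum => u /H; rewrite -leqNgt.
Qed.

Lemma tight_contradiction : False.
Proof.
have [u [v1 [v2 [uI l1 l2 v12 [uv1 uv2]]]]] := two_leaves.
have [v1S w1S d1 dw1] := leafP l1; have [v2S w2S d2 dw2] := leafP l2.
have w12 : f v1 != f v2 by rewrite (inj_eq (inv_inj fK)).
have uw v : deg (f v) I = 0 -> ~~ adj u (f v).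
  by move/eqP/deg_eq0P=> H; apply/negP; rewrite adj_sym => /H; rewrite uI.
have v1w2 : v1 != f v2 by apply: contraTneq uv1 => ->; apply: uw.
have v2w1 : v2 != f v1 by apply: contraTneq uv2 => ->; apply: uw.
have [b /setIP[]] : exists b, b \in nbhd (f v1) :&: T.
  by apply/set0Pn; rewrite -card_gt0 -/(deg _ _) degw_T // subn_gt0 ltnW.
rewrite in_nbhd => wb bT.
(* In [T], the vertex [b] has [d - 1] neighbours and [v1] only [d - 2]. *)
have [c [cT bc v1c]] : exists c, [/\ c \in T, adj b c & ~~ adj v1 c].
  case: (boolP [exists c in T, adj b c && ~~ adj v1 c]).
    by case/exists_inP=> c cT /andP[bc v1c]; exists c.
  move/exists_inPn=> H.
  suff : deg b T <= deg v1 T by rewrite degT_T // degv_T //; clear -d3; lia.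
  apply: subset_leq_card; apply/subsetP=> t; rewrite !in_setI !in_nbhd => /andP[bt tT].
  by move: (H t tT); rewrite bt tT negbK => ->.
(* Otherwise, from a matching containing [bc], rematch [f v1] with [b] and [u] with [v2]: this
   covers [u] and exposes [v1], [c] and [f v2], leaving an independent set of [#|I| + 2]
   vertices. *)
have w2c : adj (f v2) c.
  have e1 : extends f (link f b c) by apply: link_extends; rewrite ?fixT.
  have [F [FM gF] FI] := perfect e1.
  have [_ fF] := extends_trans e1 (conj FM gF).
  have [FK _] := is_matchingP _ FM.
  have Fv1 : F v1 = f v1 by apply: fF; rewrite -inS.
  have Fw1 : F (f v1) = v1 by rewrite -{1}Fv1 FK.
  have Fv2 : F v2 = f v2 by apply: fF; rewrite -inS.
  have Fb : F b = c by rewrite gF link_left // eq_sym adj_neq.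
  have Fu : F u = u by apply/eqP; move: uI; rewrite -FI inE.
  have M1 := link_matching FM wb.
  set F1 := link F (f v1) b in M1.
  have F1u : F1 u = u.
    rewrite /F1 link_id ?Fw1 ?Fb //.
    - by apply: contraTneq uI => ->; apply: notI_S.
    - by apply: contraTneq uI => ->; apply: notI_T.
    - by apply: contraTneq uI => ->; apply: notI_S.
    - by apply: contraTneq uI => ->; apply: notI_T.
  have F1v2 : F1 v2 = f v2.
    by rewrite /F1 link_id ?Fw1 ?Fb // 1?eq_sym // neqTS.
  have M2 := link_matching M1 uv2.
  apply/negPn/negP => w2c.
  have E : fixed (link F1 u v2) = f v2 |: (v1 |: (c |: (I :\ u))).
    rewrite fixed_link // F1u F1v2 /F1 fixed_link // Fw1 Fb FI.
    have nIS x y : x \in I -> y \in S -> x != y.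
      by move=> xI; apply: contraTneq => <-; apply: contraL xI; apply: notI_S.
    have nIT x y : x \in I -> y \in T -> x != y.
      by move=> xI; apply: contraTneq => <-; apply: contraL xI; apply: notI_T.
    have nSf v : v \in S -> v != f v by rewrite inS eq_sym.
    apply/setP=> x; rewrite !inE !negb_or.
    case: (eqVneq x u) => [->|xu] /=.
      by rewrite (negbTE (nIS _ _ uI w2S)) (negbTE (nIS _ _ uI v1S)) (negbTE (nIT _ _ uI cT)).
    case: (eqVneq x (f v2)) => [->|xw2] /=; first by rewrite eq_sym nSf.
    case: (eqVneq x v1) => [->|xv1] /=.
      by rewrite v12 nSf //= andbT [v1 == b]eq_sym neqTS // orbT.
    case: (eqVneq x c) => [->|xc] /=.
      by rewrite (neqTS cT v2S) (neqTS cT w1S) /= [c == b]eq_sym (adj_neq bc).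
    case: (boolP (x \in I)) => xI /=; last by rewrite !andbF.
    by rewrite (nIS _ _ xI v2S) (nIS _ _ xI w1S) (nIT _ _ xI bT).
  have Ai : independent (f v2 |: (v1 |: (c |: (I :\ u)))).
    apply: independent_setU1.
      apply: independent_setU1.
        apply: independent_setU1; first by move=> x y /setD1P[_ xI] /setD1P[_ yI]; apply: indepI.
        by move=> y /setD1P[_]; apply: nadjI; apply: degT_I.
      move=> y /setU1P[->//|/setD1P[yu yI]].
      apply/negP=> v1y; move/eqP/cards1P: d1 => [t e].
      have : y \in [set t] by rewrite -e !inE v1y.
      have : u \in [set t] by rewrite -e !inE adj_sym uv1.
      by rewrite !inE => /eqP ut /eqP yt; rewrite yt ut eqxx in yu.
    move=> y /setU1P[->|/setU1P[->//|/setD1P[_]]]; last exact: nadjI.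
    apply/negP=> w2v1; have w2v2 : adj (f v2) v2 by rewrite adj_sym; apply: fadj; rewrite -inS.
    by move: v12; rewrite (uniqS (degS1 w2S) v1S v2S w2v1 w2v2) eqxx.
  have := max_fixed M2; rewrite E => /(_ Ai).
  rewrite !cardsU1 (cardsD1 u I) uI !inE.
  rewrite (negbTE (notI_T cT)) (negbTE (notI_S v1S)) (negbTE (notI_S w2S)).
  rewrite eq_sym (negbTE v1w2) [v1 == c]eq_sym (negbTE (neqTS cT v1S)).
  by rewrite [_ == c]eq_sym (negbTE (neqTS cT w2S)) !andbF /=; clear; lia.
have [a1 /setIP[]] : exists a, a \in nbhd v1 :&: T.
  by apply/set0Pn; rewrite -card_gt0 -/(deg _ _) degv_T // subn_gt0.
have [a2 /setIP[]] : exists a, a \in nbhd v2 :&: T.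
  by apply/set0Pn; rewrite -card_gt0 -/(deg _ _) degv_T // subn_gt0.
rewrite !in_nbhd => va2 a2T va1 a1T.
have a2c := leaf_eq l2 a2T va2 cT w2c.
(* A neighbour [t] of [f v1] in [T] is [b] or starts a path [t], [a1], [b], [c], so [path4] makes it
   adjacent to [c]. Equal degrees into [T] give the converse. Then [a2] has two neighbours in [S],
   namely [v2] and [f v1]. *)
have w1a2 : adj (f v1) a2.
  apply: (@deg_sub (f v1) c T) => //; last by rewrite adj_sym.
    by rewrite (degT_T cT) (degw_T l1).
  move=> t tT w1t; case: (eqVneq t b) => [->|tb]; first by rewrite adj_sym.
  have at1 := leaf_eq l1 a1T va1 tT w1t.
  have ab1 := leaf_eq l1 a1T va1 bT wb.
  rewrite adj_sym; apply: (path4 tT a1T bT cT) => //.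
  - by rewrite adj_sym.
  - apply: contraTneq w1t => ->; apply/negP=> w1c.
    move: w12; rewrite (uniqS (degT1 cT) w1S w2S) ?eqxx // adj_sym //.
  - by apply: contraNneq v1c => <-.
by move: v2w1; rewrite (uniqS (degT1 a2T) v2S w1S) ?eqxx // adj_sym.
Qed.
End Tight.

(** * The case where no first vertex can be chosen *)

Lemma isomorphic_biclique (G : sgraph) (d : nat) (A : {set G}) :
  0 < d -> #|A| = d -> #|~: A| = d ->
  (forall x y, adj x y = ((x \in A) != (y \in A))) ->
  isomorphic G (complete_bipartite d d).
Proof.
move=> d0 cA cB adjE.
have [a aA] : exists a, a \in A by apply/set0Pn; rewrite -card_gt0 cA.
have [b bB] : exists b, b \in ~: A by apply/set0Pn; rewrite -card_gt0 cB.
pose F (x : G) : 'I_d + 'I_d :=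
  if x \in A then inl (cast_ord cA (enum_rank_in aA x))
  else inr (cast_ord cB (enum_rank_in bB x)).
exists F; split; last first.
  by move=> x y; rewrite adjE /F; case: (x \in A); case: (y \in A).
apply: inj_card_bij.
  move=> x y; rewrite /F; case: ifP => xA; case: ifP => yA //.
    by move=> e; have := cast_ord_inj (inl_inj e); apply: enum_rank_in_inj.
  by move=> e; have := cast_ord_inj (inr_inj e); apply: enum_rank_in_inj; rewrite inE ?xA ?yA.
by rewrite card_sum !card_ord -(cardsC A) cA cB.
Qed.

Section NoConfiguration.
Variables (G : sgraph) (d : nat).
Hypotheses (d0 : 0 < d) (reg : regular d G) (Gc : connected G).
Variable f : {ffun G -> G}.
Hypotheses (fM : is_matching f) (f_id : forall x, f x = x).
Hypothesis all_stuck : forall x, stuck f x.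

Let stuckP x : f x = x -> 0 < free_deg f x <= d -> stuck f x.
Proof. by move=> *; apply: all_stuck. Qed.

(** Once [p] is made the only obstruction for [x], the partner [r] of [t] is adjacent to [x]. If
    [rt] is an old edge of [g], a second exchange, seen from [y], gives [adj y t]; otherwise [rt] is
    the new edge joining [y] and [g p]. *)
Let reach g x y p t : half_pair f g x y -> half_pair f g y x ->
  adj x p -> adj p t -> adj y t \/ t = y /\ exists2 z, adj x z & adj y z.
Proof.
move=> hxy hyx xp pt.
case: (eqVneq p y) => [<-|py]; first by left.
have [ygp gpx hp] := pair_reach fM hxy hyx (all_stuck x) (all_stuck y) xp (f_id p) py.
have [fg xy gx gy _] := hxy; have [gM _] := fg.
have [gK _] := is_matchingP _ gM.
have [fg' _ lx lp _] := hp; have [lM _] := fg'.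
have [lK _] := is_matchingP _ lM.
case: (eqVneq t x) => [->|tx]; first by left; rewrite adj_sym.
have [lt xlt] := optimal_exchange fM (half_pair_optimal (all_stuck x) hp) xp lp pt tx (f_id t).
set r := link g y (g p) t in lt xlt.
have tr : t = link g y (g p) r by rewrite lK.
case: (eqVneq r y) => [ry|ry]; first by left; rewrite tr ry link_left.
case: (eqVneq r (g p)) => [rgp|rgp].
  right; split; last by exists (g p); rewrite // -rgp.
  by rewrite tr rgp ffunE eqxx; case: eqP.
have rp : r != p by apply: contra lt => /eqP e; rewrite tr e lp.
have tgr : t = g r by rewrite tr link_id // ?gy ?gK.
have [_] := optimal_exchange fM (half_pair_optimal (all_stuck y) hyx)
   (etrans (adj_sym y x) xy) gx xlt ry (f_id r).
by rewrite tgr; left.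
Qed.

Lemma all_stuck_biclique :
  #|G| < 2 * d \/ isomorphic G (complete_bipartite d d).
Proof.
have [/card_gt0P[x _] Gconn] := Gc.
have kx : 0 < free_deg f x <= d.
  have -> : free_deg f x = d.
    rewrite -(deg_setT reg x) /free_deg; congr #|pred_of_set (_ :&: _)|.
    by apply/setP=> z; rewrite !inE f_id eqxx.
  by rewrite d0 leqnn.
have [g [y [hxy hyx _ _]]] := pair_exists fM stuckP (f_id x) kx.
have [_ xy _ _ _] := hxy.
have Nx : #|nbhd x| = d := reg x; have Ny : #|nbhd y| = d := reg y.
(* The union is closed under adjacency by [reach], used in both directions. *)
have cover_nbhd : nbhd x :|: nbhd y = setT.
  have Bc : closed (@adj G) (mem (nbhd x :|: nbhd y)).
    apply: intro_closed; first exact/sym_connect_sym/adj_sym.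
    move=> p t pt; rewrite !inE => /orP[xp|yp].
      by have [->|[->]] := reach hxy hyx xp pt; rewrite ?orbT ?xy.
    by have [->|[->]] := reach hyx hxy yp pt; rewrite // adj_sym xy orbT.
  apply/setP=> t; have := closed_connect Bc (Gconn y t); rewrite inE.
  by rewrite !inE xy /= => <-.
have cG : #|G| + #|nbhd x :&: nbhd y| = 2 * d.
  by rewrite -cardsT -cover_nbhd cardsUI Nx Ny; lia.
case: (eqVneq (nbhd x :&: nbhd y) set0) => [I0|]; last by rewrite -card_gt0; left; lia.
have disj z : adj x z -> adj y z -> False.
  by move=> xz yz; move/setP/(_ z): I0; rewrite !inE xz yz.
have NC : ~: nbhd x = nbhd y.
  apply/setP=> z; move/setP/(_ z): cover_nbhd; rewrite !inE.
  case xz: (adj x z) => /=; last by move->.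
  by move=> _; apply/esym/negP; apply: disj.
right; apply: (@isomorphic_biclique _ _ (nbhd x)) => //; first by rewrite NC.
(* Without common neighbours the exceptional case of [reach] vanishes, and an inclusion between
   neighbourhoods of size [d] is an equality. *)
have nbrs g' u v p : half_pair f g' u v -> half_pair f g' v u ->
    (forall z, adj u z -> adj v z -> False) -> adj u p -> nbhd p = nbhd v.
  move=> huv hvu dis up; apply/eqP; rewrite eqEcard [#|nbhd p|]reg [#|nbhd v|]reg leqnn andbT.
  apply/subsetP=> t; rewrite !inE => pt.
  by case: (reach huv hvu up pt) => [//|[_ [z uz vz]]]; case: (dis z).
have side z : (adj x z) = ~~ adj y z.
  by have /setP/(_ z) := NC; rewrite !inE => <-; rewrite negbK.
move=> p q; rewrite -!in_nbhd; case: (boolP (p \in nbhd x)); rewrite in_nbhd => xp.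
  by rewrite (nbrs _ _ _ _ hxy hyx disj xp) !in_nbhd side; case: adj.
have yp : adj y p by apply: contraR xp => yp; rewrite side yp.
have disj' z : adj y z -> adj x z -> False by move=> yz xz; apply: disj xz yz.
by rewrite (nbrs _ _ _ _ hyx hxy disj' yp) !in_nbhd; case: adj.
Qed.

End NoConfiguration.

(** * Existence of a maximal matching missing many vertices *)

Lemma sparse_maximal_matching (G : sgraph) (d : nat) :
  3 <= d -> connected G -> regular d G ->
  isomorphic G (complete_bipartite d d) \/
  exists f : {ffun G -> G}, [/\ is_matching f, independent (fixed f) &
    #|G| < (d - 1) * (2 * d - 1) * #|fixed f| + 2 * d].
Proof.
move=> d3 Gc reg; have d0 : 0 < d by apply: leq_trans d3.
pose P (f : {ffun G -> G}) :=
  [&& is_matching f, [forall x in fixed f, forall y in fixed f, ~~ adj x y] &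
   #|G| < (d - 1) * (2 * d - 1) * #|fixed f| + 2 * d].
have PE f : reflect [/\ is_matching f, independent (fixed f) &
    #|G| < (d - 1) * (2 * d - 1) * #|fixed f| + 2 * d] (P f).
  apply: (iffP and3P) => -[fM fi lt]; split=> //.
    by move=> x y xf yf; apply: (forall_inP (forall_inP fi x xf)).
  by apply/forall_inP=> x xf; apply/forall_inP=> y; apply: fi.
case: (boolP [exists f, P f]) => [/existsP[f /PE Pf]|/existsPn H].
  by right; exists f.
have large (g : {ffun G -> G}) : is_matching g -> independent (fixed g) ->
    (d - 1) * (2 * d - 1) * #|fixed g| + 2 * d <= #|G|.
  by move=> gM gi; rewrite leqNgt; apply/negP=> lt; case/negP: (H g); apply/PE.
have [f [I [fI maxI]]] := max_config G d.
have fM := config_matching fI.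
case: (eqVneq I set0) => [I0|I0]; last first.
  by case: (tight_contradiction d3 reg fI (max_config_covered reg d0 Gc fI maxI I0) large).
have f_id x : f x = x := config_set0 x fI I0.
have st x : stuck f x.
  apply: (max_config_stuck reg (k := d) d0 fI maxI) => //; first by rewrite I0 eqxx.
  have -> : free_deg f x = d.
    rewrite -(deg_setT reg x) /free_deg; congr #|pred_of_set (_ :&: _)|.
    by apply/setP=> z; rewrite !inE f_id eqxx.
  by rewrite d0 leqnn.
have [lt|] := all_stuck_biclique d0 reg Gc fM f_id st; last by left.
(* As [#|G| < 2 * d], any maximal matching will do, even a perfect one. *)
right; have [g fg gi] := maximal_extension fM; exists g; split=> //; first exact: fg.1.
by apply: leq_trans lt _; apply: leq_addl.
Qed.

(** * From involutions to sets of edges *)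

Lemma edgesP (G : sgraph) (e : {set G}) :
  reflect (exists x y, adj x y /\ e = [set x; y]) (e \in edges G).
Proof.
rewrite inE; apply: (iffP existsP) => [[x /existsP[y /andP[xy /eqP->]]]|[x [y [xy ->]]]].
  by exists x, y.
by exists x; apply/existsP; exists y; rewrite xy eqxx.
Qed.

Lemma edge_domination_le (G : sgraph) (f : {ffun G -> G}) :
  is_matching f -> independent (fixed f) ->
  2 * edge_domination_number G + #|fixed f| <= #|G|.
Proof.
move=> fM fi; have [fK fadj] := is_matchingP _ fM.
pose e x := [set x; f x].
pose M := e @: ~: fixed f.
have eE x y : x \in e y -> e y = e x.
  by rewrite !inE => /orP[]/eqP->; rewrite /e ?fK // setUC.
have tM : trivIset M.
  apply/trivIsetP=> _ _ /imsetP[x _ ->] /imsetP[y _ ->]; apply: contraR.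
  by case/pred0Pn=> z /andP[/= /eE-> /eE->].
have Mmatch : matching M.
  rewrite /matching tM andbT; apply/subsetP=> a /imsetP[x xf ->].
  have fx : f x != x by move: xf; rewrite !inE.
  by apply/edgesP; exists x, (f x); split=> //; apply: fadj.
have cM : #|M| * 2 = #|~: fixed f|.
  apply/esym/card_uniform_partition.
    move=> a /imsetP[x xf ->]; move: xf; rewrite !inE => fx.
    by rewrite cards2 eq_sym fx.
  apply/and3P; split=> //; last first.
    by apply/imsetP=> -[x _ /setP/(_ x)]; rewrite !inE eqxx.
  apply/eqP/setP=> x; apply/bigcupP/idP => [[_ /imsetP[y yf ->]]|xf].
    by move: yf; rewrite !inE => fy /orP[]/eqP-> //; rewrite fK eq_sym.
  by exists (e x); [apply: imset_f | rewrite !inE eqxx].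
have Mmax : maximal_matching M.
  apply/maxsetP; split=> // N /andP[NE Nt] MN; apply/eqP; rewrite eqEsubset MN andbT.
  apply/subsetP=> a aN; have /edgesP[x [y [xy aE]]] := subsetP NE a aN.
  have inM z : z \in a -> f z != z -> a \in M.
    move=> za fz; have ezM : e z \in M by apply: imset_f; rewrite !inE.
    rewrite (_ : a = e z) //; apply/eqP; apply: contraT => ne.
    move/trivIsetP: Nt => /(_ _ _ aN (subsetP MN _ ezM) ne)/pred0P/(_ z) /=.
    by rewrite za !inE eqxx.
  case: (boolP (f x == x)) => fx; last by apply: inM fx; rewrite aE !inE eqxx.
  case: (boolP (f y == y)) => fy; last by apply: inM fy; rewrite aE !inE eqxx orbT.
  by have := fi x y; rewrite !inE fx fy xy => /(_ isT isT).
have : edge_domination_number G <= #|M|.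
  rewrite /edge_domination_number; case: ex_minnP => m _; apply.
  by apply/existsP; exists M; rewrite Mmax eqxx.
by have := cardsC (fixed f); lia.
Qed.

Lemma biclique_edge_domination_ge (G : sgraph) (d : nat) :
  isomorphic G (complete_bipartite d d) ->
  #|G| = 2 * d /\ d <= edge_domination_number G.
Proof.
case=> F [Fbij Fadj]; split.
  by rewrite (bij_eq_card Fbij) card_sum !card_ord; lia.
rewrite /edge_domination_number; case: ex_minnP => m /existsP[M /andP[/maxsetP[]]].
case/andP=> ME Mt Mmax /eqP <- _; rewrite leqNgt; apply/negP=> lt.
have [H FK HK] := Fbij.
have HE (s : 'I_d + 'I_d) (t : 'I_d + 'I_d) : adj (H s) (H t) = biclique_adj s t.
  by rewrite -Fadj !HK.
(* No edge contains two vertices of one side, so covering a side takes [d] edges. Fewer edges miss a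
   vertex on each side, and these two vertices are adjacent. *)
have uncovered (s : 'I_d -> 'I_d + 'I_d) : injective s ->
    (forall i j, biclique_adj (s i) (s j) = false) ->
    exists i, H (s i) \notin cover M.
  move=> sI sN; apply/existsP; apply: contraLR lt; rewrite negb_exists -leqNgt => /forallP cov.
  have {}cov i : H (s i) \in cover M by rewrite -[_ \in _]negbK cov.
  rewrite -[X in X <= _](card_ord d).
  have bI : {in 'I_d &, injective (fun i => pblock M (H (s i)))}.
    move=> i j _ _ /= eb; apply: sI; apply: (can_inj HK).
    have bM : pblock M (H (s i)) \in M by apply: pblock_mem.
    have /edgesP[x [y [xy bE]]] := subsetP ME _ bM.
    have := mem_pblock M (H (s i)); have := mem_pblock M (H (s j)).
    rewrite !cov -eb bE !inE => /orP[]/eqP ej /orP[]/eqP ei; rewrite ?ei ?ej //.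
      by have := sN i j; rewrite -HE ei ej adj_sym xy.
    by have := sN i j; rewrite -HE ei ej xy.
  rewrite -(card_in_imset bI); apply: subset_leq_card; apply/subsetP=> _ /imsetP[i _ ->].
  exact: pblock_mem.
have [i iN] := uncovered inl (@inl_inj _ _) (fun _ _ => erefl).
have [j jN] := uncovered inr (@inr_inj _ _) (fun _ _ => erefl).
set a := H (inl i) in iN; set b := H (inr j) in jN.
pose N := [set a; b] |: M.
have NM : N = M.
  apply: Mmax; last exact: subsetUr.
  apply/andP; split.
    rewrite subUset ME andbT sub1set; apply/edgesP; exists a, b; split=> //.
    by rewrite /a /b HE.
  have no c : c \in M -> [disjoint [set a; b] & c].
    move=> cM; apply/pred0P=> z /=; rewrite !inE; apply/andP=> -[zab zc].
    have : z \in cover M by apply/bigcupP; exists c.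
    by case/orP: zab => /eqP->; apply/negP.
  apply/trivIsetP=> c c'; rewrite !inE => /orP[/eqP->|cM] /orP[/eqP->|cM'].
  - by rewrite eqxx.
  - by move=> _; apply: no.
  - by move=> _; rewrite disjoint_sym; apply: no.
  - exact: (trivIsetP Mt).
case/negP: iN; apply/bigcupP; exists [set a; b]; last by rewrite !inE eqxx.
by rewrite -NM setU11.
Qed.

(** * The rational bound and the equality case *)

Local Open Scope ring_scope.

Theorem theorem3 (d : nat) (G : sgraph) (n : nat) (D : rat := d%:R)
    (bound : rat :=
       (D * (2 * D - 3) * n%:R + 2 * D) / (2 * (D - 1) * (2 * D - 1))) :
  (3 <= d)%N -> connected G -> regular d G -> #|G| = n ->
  (edge_domination_number G)%:R <= bound /\
  ((edge_domination_number G)%:R = bound <->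
     isomorphic G (complete_bipartite d d)).
Proof.
move=> d3 Gc reg cG.
set m := edge_domination_number G.
have D3 : 3 <= D by rewrite ler_nat.
have den : 0 < 2 * (D - 1) * (2 * D - 1) by rewrite !mulr_gt0 //; lra.
(* At [n = 2 * d] the numerator is [2 * D * (D - 1) * (2 * D - 1)]. *)
have iso_bound : isomorphic G (complete_bipartite d d) -> bound = D.
  case/biclique_edge_domination_ge=> c2 _; rewrite /bound -cG c2 natrM -/D; field.
  by rewrite !gt_eqF //; lra.
have [iso|[f [fM fi lt]]] := sparse_maximal_matching d3 Gc reg.
  rewrite (iso_bound iso); suff -> : m = d by [].
  have [g0 [I0 [/config_matching g0M _]]] := max_config G d.
  have [g [gM _] gi] := maximal_extension g0M.
  have := edge_domination_le gM gi; have [-> ge] := biclique_edge_domination_ge iso.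
  by move: ge; rewrite -/m; lia.
suff lt' : m%:R < bound.
  split; first exact: ltW.
  split=> [e|iso]; first by rewrite e ltxx in lt'.
  have [_ ge] := biclique_edge_domination_ge iso.
  by move: lt'; rewrite (iso_bound iso) ltr_nat ltnNge ge.
rewrite /bound ltr_pdivlMr //.
have := edge_domination_le fM fi; rewrite -/m cG -(ler_nat rat) natrD natrM => le.
move: lt; rewrite cG -(ltr_nat rat) natrD !natrM !natrB ?natrM ?muln_gt0 //; try lia.
rewrite -/D => lt.
(* Multiplying [2 * m + #|fixed f| <= n] by this factor and inserting [lt] leaves the coefficient
   [(D - 1) * (2 * D - 1) - 1 = D * (2 * D - 3)] at [n]. *)
have K0 : 0 <= (D - 1) * (2 * D - 1) by rewrite mulr_ge0 //; lra.
have := ler_wpM2r K0 le; move: lt.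
move: (m%:R : rat) (n%:R : rat) (#|_|%:R : rat) => M N A; lra.
Qed.
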